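(* If $b<\binom{n-1}{2}/n$, then Maker (with Breaker moving first) has a winning strategy for the triangle game $\mathcal{F}_{K_3}(S_b,n)$.
   Context: $\mathcal{F}_{K_3}(S_b,n)$ is the following game on the edge set of $K_n$: players alternate; on each turn Maker claims one unclaimed edge, and Breaker claims a set of at most $b$ unclaimed edges all incident to a common vertex (a subgraph of a star with $b$ leaves). The game ends when no unclaimed edges remain. Maker wins if her graph contains a triangle; otherwise Breaker wins. *)

(* Defs.v *)
From mathcomp Require Import all_boot all_order all_algebra.

Set Implicit Arguments.
Unset Strict Implicit.
Unset Printing Implicit Defensive.

Definition edge (n : nat) : Type := {set 'I_n}.

Definition Kn (n : nat) : {set edge n} := [set e : edge n | #|e| == 2].

Definition has_triangle (n : nat) (G : {set edge n}) : Prop :=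
  exists x y z : 'I_n,
    [/\ x != y, x != z & y != z] /\
    [/\ [set x; y] \in G, [set x; z] \in G & [set y; z] \in G].

(* A history lists the sets of edges claimed on the successive turns, most
   recent first: [A :: h] is [h] followed by the move [A].  Breaker moves first,
   so the players' turns are told apart by the parity of the length. *)
Definition history (n : nat) : Type := seq {set edge n}.

Definition maker_turn (n : nat) (h : history n) : bool := odd (size h).

Definition unclaimed (n : nat) (h : history n) : {set edge n} :=
  Kn n :\: \bigcup_(A <- h) A.

Fixpoint maker_graph (n : nat) (h : history n) : {set edge n} :=
  if h is A :: h' then
    if maker_turn h' then A :|: maker_graph h' else maker_graph h'
  else set0.

(* Breaker's moves may be empty. *)
Definition breaker_move (n b : nat) (h : history n) (A : {set edge n}) : Prop :=
  [/\ A \subset unclaimed h, #|A| <= b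
    & exists v : 'I_n, forall e : edge n, e \in A -> v \in e].

Definition maker_move (n : nat) (h : history n) (A : {set edge n}) : Prop :=
  exists2 e : edge n, e \in unclaimed h & A = [set e].

Definition game_over (n : nat) (h : history n) : Prop := unclaimed h = set0.

Fixpoint legal (n b : nat) (h : history n) : Prop :=
  if h is A :: h' then
    [/\ legal b h', ~ game_over h'
      & if maker_turn h' then maker_move h' A else breaker_move b h' A]
  else True.

(* Values on histories where Maker is not to move are irrelevant. *)
Definition maker_strategy (n : nat) : Type := history n -> edge n.

Fixpoint follows (n : nat) (s : maker_strategy n) (h : history n) : Prop :=
  if h is A :: h' then
    follows s h' /\ (maker_turn h' -> A = [set s h'])
  else True.

(* Since Maker claims an edge on each of her turns, every play reaches
   [game_over]; so it suffices to ask that the strategy never gets stuck and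
   that every finished play contains a triangle of Maker. *)
Definition winning_strategy (n b : nat) (s : maker_strategy n) : Prop :=
  forall h : history n, legal b h -> follows s h ->
    (~ game_over h -> maker_turn h -> s h \in unclaimed h) /\
    (game_over h -> has_triangle (maker_graph h)).

Definition maker_wins_triangle_game (n b : nat) : Prop :=
  exists s : maker_strategy n, winning_strategy b s.

(* Main.v *)
(* The hypothesis amounts to 2b + 3 <= n.

   Maker grows a star at a vertex c, each time adding a leaf y that is joined
   to an older leaf x by an unclaimed edge.  Breaker has to answer the threat
   xy, so he cannot claim an edge at c, and blocks at most b edges between
   leaves per round; counting shows that some edge at an old leaf is always
   unclaimed, until Maker closes a triangle.

   This works at once if, after Maker's first edge ac (avoiding Breaker's first
   star), one of a, c is still untouched.  Otherwise Breaker's second star is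
   centred at some w distinct from a and c and meets both.  Then Maker plays an
   edge pq avoiding a, c, w and the centre u of the first star.  If Breaker's
   next star is not centred at a, c, p or q, claiming cp creates the disjoint
   threats ap and cq.  If it is centred at a (say), Maker grows a star at c
   away from u and w; now every leaf x also forces Breaker to block xp and xq,
   because of the same double threat, and this compensates the lost vertices. *)

Require Import Defs.
From mathcomp Require Import all_boot all_order all_algebra.
From mathcomp Require Import zify.
From Stdlib Require Import ClassicalEpsilon.

Set Implicit Arguments.
Unset Strict Implicit.
Unset Printing Implicit Defensive.

(** * From winning positions to a strategy on histories *)

Definition star (n : nat) (A : {set edge n}) :=
  exists v : 'I_n, forall e, e \in A -> v \in e.

(* Maker, to move, wins from the position where she owns [M] and the edges of
   [U] are unclaimed. *)
Inductive win (n b : nat) (M U : {set edge n}) : Prop :=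
| win_triangle of has_triangle M
| win_move e of e \in U
    & forall A : {set edge n}, A \subset U :\ e -> #|A| <= b -> star A ->
        win b (e |: M) (U :\ e :\: A).

Definition good_move (n b : nat) (M U : {set edge n}) (e : edge n) :=
  e \in U /\
  forall A : {set edge n}, A \subset U :\ e -> #|A| <= b -> star A ->
    win b (e |: M) (U :\ e :\: A).

Lemma has_triangleS n (M M' : {set edge n}) :
  M \subset M' -> has_triangle M -> has_triangle M'.
Proof.
move=> /subsetP sMM' [x [y [z [xyz [Mxy Mxz Myz]]]]].
by exists x, y, z; split=> //; split; apply: sMM'.
Qed.

Lemma win_good_move n b (M U : {set edge n}) :
  win b M U -> U != set0 -> exists e, good_move b M U e.
Proof.
case=> [triM /set0Pn[e Ue] | e Ue wine _]; last by exists e.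
exists e; split=> // A _ _ _.
exact/win_triangle/(has_triangleS _ triM)/subsetUr.
Qed.

Lemma win_set0 n b (M : {set edge n}) : win b M set0 -> has_triangle M.
Proof. by case=> // e; rewrite inE. Qed.

(** Only the current position is read off the history; where no good move exists, the value of
    [epsilon] is arbitrary. *)
Definition winning_moves (n b : nat) : maker_strategy n := fun h =>
  epsilon (inhabits (set0 : edge n))
    (good_move b (maker_graph h) (unclaimed h)).

Lemma unclaimed_cons n (A : {set edge n}) (h : history n) :
  unclaimed (A :: h) = unclaimed h :\: A.
Proof. by rewrite /unclaimed big_cons setUC setDDl. Qed.

Lemma unclaimed_nil n : unclaimed [::] = Kn n.
Proof. by rewrite /unclaimed big_nil setD0. Qed.

(** Since [win] describes positions with Maker to move, the invariant at Breaker's turns has to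
    range over all his answers. *)
Lemma winning_moves_invariant n b :
  (forall A : {set edge n}, A \subset Kn n -> #|A| <= b -> star A ->
     win b set0 (Kn n :\: A)) ->
  forall h : history n, legal b h -> follows (winning_moves b) h ->
  if maker_turn h then win b (maker_graph h) (unclaimed h)
  else forall A : {set edge n}, A \subset unclaimed h -> #|A| <= b -> star A ->
         win b (maker_graph h) (unclaimed h :\: A).
Proof.
move=> win0; elim=> [|A h IH]; first by rewrite unclaimed_nil.
move=> /= [legh /eqP overh mvA] [folh defA].
rewrite /maker_turn /= -/(maker_turn h) unclaimed_cons.
case: ifP (IH legh folh) mvA defA => turn winh.
  rewrite /= => _ /(_ isT) ->.
  by case: (epsilon_spec (inhabits (set0 : edge n)) _
    (win_good_move winh overh)).
by move=> [sAU cA stA] _; apply: winh.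
Qed.

Lemma maker_wins_of_win n b : 0 < n ->
  (forall A : {set edge n}, A \subset Kn n -> #|A| <= b -> star A ->
     win b set0 (Kn n :\: A)) ->
  maker_wins_triangle_game n b.
Proof.
move=> n_gt0 win0; exists (winning_moves b) => h legh folh.
have := winning_moves_invariant win0 legh folh.
case: ifP => turn inv; split=> over //.
- by move=> _; have [] := epsilon_spec (inhabits (set0 : edge n)) _
    (win_good_move inv (introN eqP over)).
- by apply: (@win_set0 _ b); rewrite -over.
(* The game ended on Breaker's turn: feeding his empty move to the invariant gives a position of
   Maker with no edge left. *)
- apply: (@win_set0 _ b); rewrite -(set0D set0) -{1}over.
  apply: inv; rewrite ?sub0set ?cards0 //.
  by exists (Ordinal n_gt0) => e; rewrite inE.
Qed.

(** * Single and double threats *)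

Lemma win_now n b (M U : {set edge n}) (x y z : 'I_n) :
  x != y -> x != z -> y != z ->
  [set x; y] \in M -> [set x; z] \in M -> [set y; z] \in U -> win b M U.
Proof.
move=> xy xz yz Mxy Mxz Uyz; apply: (win_move Uyz) => A _ _ _.
apply: win_triangle; exists x, y, z.
by split; split; rewrite // !inE ?eqxx ?Mxy ?Mxz ?orbT.
Qed.

(* Claiming [cp] creates the two disjoint threats [xp] and [cq], which no star
   can both meet. *)
Lemma win_double_threat n b (M U : {set edge n}) (c x p q : 'I_n) :
  uniq [:: c; x; p; q] ->
  [set c; x] \in M -> [set p; q] \in M ->
  [set c; p] \in U -> [set c; q] \in U -> [set x; p] \in U -> win b M U.
Proof.
rewrite /= !inE !negb_or => /and4P[/and3P[cx cp cq] /andP[xp xq] pq _].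
move=> Mcx Mpq Ucp Ucq Uxp; apply: (win_move Ucp) => A sA _ [v stA].
have neq2 (s t : edge n) (y : 'I_n) : y \in s -> y \notin t -> s != t.
  by move=> ys; apply: contraNneq => <-.
have cqcp : [set c; q] != [set c; p].
  apply: (neq2 _ _ q); rewrite !inE ?eqxx ?orbT // negb_or.
  by rewrite ![q == _]eq_sym cq pq.
have xpcp : [set x; p] != [set c; p].
  apply: (neq2 _ _ x); rewrite !inE ?eqxx ?orbT // negb_or.
  by rewrite [x == c]eq_sym cx xp.
case: (boolP ([set x; p] \in A)) => Axp; last first.
  apply: (@win_now _ _ _ _ c x p) => //; rewrite ?inE ?eqxx ?Mcx ?orbT //.
  by rewrite Axp xpcp Uxp.
case: (boolP ([set c; q] \in A)) => Acq; last first.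
  apply: (@win_now _ _ _ _ p c q) => //; rewrite ?[p == c]eq_sym //;
    rewrite ?inE ?eqxx ?Mpq ?orbT //.
    by rewrite setUC eqxx.
  by rewrite Acq cqcp Ucq.
(* Otherwise the centre of Breaker's star lies on both [xp] and [cq], which are disjoint. *)
have := stA _ Axp; have := stA _ Acq; rewrite !inE.
case/orP=> /eqP-> /orP[] /eqP E; move: cx cp xq pq; rewrite E ?eqxx //.
Qed.

(** * Growing a star while counting blocked edges *)

Lemma in_Kn n (x y : 'I_n) : ([set x; y] \in Kn n) = (x != y).
Proof. by rewrite inE cards2; case: (x != y). Qed.

Lemma KnP n (e : edge n) z : e \in Kn n -> z \in e ->
  exists2 y, z != y & e = [set z; y].
Proof.
rewrite inE => /cards2P[x [y [xy ->]]] /set2P[->|->]; first by exists y.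
by exists x; rewrite 1?eq_sym // setUC.
Qed.

Lemma set2_neq (T : finType) (x y z t : T) :
  x != z -> x != t -> [set x; y] != [set z; t].
Proof.
move=> xz xt; apply/eqP => /setP/(_ x).
by rewrite !inE eqxx (negPf xz) (negPf xt).
Qed.

(** Meant to count Breaker's edges only: Maker's star edges leave [V], and her edge [pq] is exempted
    as lying inside [Q]. *)
Definition blocked (n : nat) (V Q : {set 'I_n}) (U : {set edge n}) :=
  [set e in Kn n | [&& e \subset V, ~~ (e \subset Q) & e \notin U]].

(** Otherwise each pair in [V] either avoids [L], or meets [L], hence is not inside [Q], and is
    blocked; there are too few of these. *)
Lemma open_edge_at_leaf n (V Q L : {set 'I_n}) (U : {set edge n}) :
  L \subset V -> [disjoint L & Q] ->
  #|blocked V Q U| + 'C(#|V| - #|L|, 2) < 'C(#|V|, 2) ->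
  exists x y, [/\ x \in L, y \in V, x != y & [set x; y] \in U].
Proof.
move=> sLV dLQ few.
have [/existsP[x /existsP[y /and4P[]]]|none] :=
  boolP [exists x, exists y, [&& x \in L, y \in V, x != y & [set x; y] \in U]].
  by exists x, y.
move: few; rewrite ltnNge -(cards_draws V 2).
have <- : #|V :\: L| = #|V| - #|L| by rewrite cardsD (setIidPr sLV).
rewrite -cards_draws; case/negP.
apply: leq_trans (leq_card_setU _ _); apply/subset_leq_card/subsetP=> e.
rewrite !inE => /andP[seV ce]; rewrite ce seV /=.
have [//|/subsetPn[z ez]] := boolP (e \subset V :\: L); first by rewrite orbT.
have zV := subsetP seV _ ez.
rewrite !inE zV andbT negbK => zL; rewrite orbF.
have eK : e \in Kn n by rewrite inE.
have [y zy def_e] := KnP eK ez.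
apply/andP; split.
  apply/subsetPn; exists z => //.
  by rewrite (disjointFr dLQ zL).
apply: contra none => Ue; apply/existsP; exists z; apply/existsP; exists y.
by rewrite zL zy -def_e Ue (subsetP seV) // def_e !inE eqxx orbT.
Qed.

(* [L] are the current leaves of Maker's star at [c], [V :\: (L :|: Q)] the
   possible further leaves, and [Q] is either empty or a pair joined by Maker
   and not yet joined to [c].  [beta] accounts for what Breaker blocked before
   the first leaf. *)
Lemma win_star n b beta (c : 'I_n) (V Q : {set 'I_n}) :
  c \notin V -> Q \subset V ->
  (forall k, 0 < k -> k + #|Q| <= #|V| ->
     beta + b * k + 'C(#|V| - k, 2) < 'C(#|V|, 2)) ->
  forall (M U : {set edge n}) (L : {set 'I_n}),
  L \subset V -> [disjoint L & Q] -> 0 < #|L| ->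
  (forall x, x \in L -> [set c; x] \in M) ->
  (forall y, y \in V :\: L -> [set c; y] \in U) ->
  (forall p, p \in Q -> exists2 q, q \in Q :\ p & [set p; q] \in M) ->
  #|blocked V Q U| <= beta + b * #|L| ->
  win b M U.
Proof.
(* Induction on the number of vertices of [V] that are not yet leaves. *)
move=> cV sQV count M U L; move: {2}#|V :\: L| (erefl #|V :\: L|) => m.
elim: m M U L => [|m IH] M U L cardVL sLV dLQ L_gt0 ML UL MQ few.
all: have cNV z : z \in V -> c != z by apply: contraTneq => <-.
all: have LQ_V : #|L| + #|Q| <= #|V|
  by move: (subset_leq_card (introT subUsetP (conj sLV sQV)));
     rewrite (eqP (_ : #|L :|: Q| == #|L| + #|Q|)) // (leq_card_setU L Q).
all: have [|x [y [xL yV xy Uxy]]] := @open_edge_at_leaf _ V Q L U sLV dLQ;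
  first by apply: leq_ltn_trans (count _ L_gt0 LQ_V); rewrite leq_add2r.
all: have xV := subsetP sLV _ xL.
all: have [yL|yL] := boolP (y \in L);
  first by apply: (@win_now _ _ _ _ c x y); rewrite ?cNV ?ML.
  by move/eqP: cardVL; rewrite cards_eq0 => /eqP/setP/(_ y); rewrite !inE yL yV.
have Ucy : [set c; y] \in U by rewrite UL // inE yL.
(* An open edge from a leaf into the pair gives the double threat [xy], [cq] by claiming [cy]. *)
have [yQ|yQ] := boolP (y \in Q).
  have [q /setD1P[qy qQ] Myq] := MQ y yQ.
  have qV := subsetP sQV _ qQ.
  have qL : q \notin L by rewrite (disjointFl dLQ qQ).
  apply: (@win_double_threat _ _ _ _ c x y q); rewrite ?ML ?(UL q) ?inE ?qL //.
  rewrite /= !inE !negb_or !cNV // xy [y == q]eq_sym qy !andbT.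
  by apply: contraNneq qL => <-.
apply: (win_move Ucy) => A sA cA [v stA].
have [Axy|Axy] := boolP ([set x; y] \in A); last first.
  apply: (@win_now _ _ _ _ c x y); rewrite ?cNV ?inE ?(ML x) ?eqxx ?orbT //.
  by rewrite Axy Uxy set2_neq // eq_sym cNV.
have vxy := stA _ Axy.
apply: (IH _ _ (y |: L)).
- by move: cardVL; rewrite (cardsD1 y) !inE yL yV setDDl setUC => -[].
- by rewrite subUset sub1set yV.
- by rewrite -setI_eq0 setIUl setU_eq0 !setI_eq0 disjoints1 yQ.
- by rewrite cardsU1 yL.
- by move=> z /setU1P[->|zL]; rewrite !inE ?eqxx // ML ?orbT.
(* Having had to take [xy], Breaker's star is centred at [x] or [y], so it contains no [cz] with [z]
   still free. *)
- move=> z; rewrite !inE negb_or => /andP[/andP[zy zL] zV].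
  rewrite UL ?inE ?zL // setUC [X in _ != X]setUC andbT.
  have zx : z != x by apply: contraNneq zL => ->.
  rewrite set2_neq //= 1?eq_sym ?cNV // andbT.
  apply/negP => /stA.
  case/set2P: vxy => ->; rewrite !inE ![_ == z]eq_sym (negPf zx, negPf zy) /= ;
   by rewrite eq_sym (negPf (cNV _ _)).
- by move=> p /MQ[q qQ Mpq]; exists q; rewrite // inE Mpq orbT.
(* Only [A] adds to the blocked edges, since [cy] does not lie inside [V]. *)
rewrite cardsU1 yL mulnDr muln1 addnCA.
have: #|blocked V Q U :|: A| <= b + (beta + b * #|L|).
  by rewrite addnC (leq_trans (leq_card_setU _ _)) ?leq_add.
apply: leq_trans; apply/subset_leq_card/subsetP=> e.
rewrite !inE => /and4P[-> seV -> /=]; rewrite seV /=.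
have -> : e != [set c; y].
  by apply: contraNneq cV => ec; apply: (subsetP seV); rewrite ec !inE eqxx.
by rewrite !negb_and negbK orbC => /orP[->|->] //; rewrite orbT.
Qed.

(** * Binomial inequalities behind the count *)

Lemma double_bin2 m : 2 * 'C(m, 2) = m * m.-1.
Proof. by elim: m => // m IH; rewrite binS bin1; case: m IH => //= m; lia. Qed.

Lemma bin2D k j : 'C(k + j, 2) = 'C(k, 2) + 'C(j, 2) + k * j.
Proof. by elim: k => [|k IH]; rewrite ?addn0 // addSn !binS !bin1 IH; lia. Qed.

Lemma star_count b N k : 2 * b + 2 <= N -> 0 < k -> k <= N ->
  b + b * k + 'C(N - k, 2) < 'C(N, 2).
Proof.
case: k => // i bN _ iN.
have [j def_N] : exists j, N = i.+1 + j by exists (N - i.+1); lia.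
(* Here [i + j] is [N - 1]. Twice the gap between the binomials is [(i + 1) * (i + 2 * j)], at least
   [(i + j) * (i + 2) - i]; the 1 in [2 * b + 1] absorbs the loss of [i]. *)
have : (2 * b + 1) * (i + 2) <= (i + j) * (i + 2) by rewrite leq_mul2r; lia.
by rewrite def_N addKn bin2D; have := double_bin2 i.+1; rewrite /=; lia.
Qed.

(** Twice the gap is [k * (2 * N - k - 1)], and leaves avoiding the pair make the second factor
    exceed [N]; so [N] may be two smaller than in [star_count]. *)
Lemma star_count_pair b N k : 2 * b <= N -> 0 < k -> k + 2 <= N ->
  b * k + 'C(N - k, 2) < 'C(N, 2).
Proof.
move=> bN k_gt0 kN.
have [j def_N] : exists j, N = k + (j + 2) by exists (N - k - 2); lia.
have : 2 * b * k <= (k + j + 2) * k by rewrite leq_mul2r; lia.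
have := double_bin2 k; case: k k_gt0 {kN} def_N => // k _ ->.
by rewrite addKn (bin2D k.+1) /=; lia.
Qed.

(** * The opening moves *)

Lemma cardsC_geq n (S : {set 'I_n}) k : #|S| <= k -> n <= #|~: S| + k.
Proof. by have := cardsC S; rewrite card_ord; lia. Qed.

(** [win_star] with no pair and all other vertices available; the bound [b + b] stands for Breaker's
    first two stars. *)
Lemma win_untouched_end n b (M U : {set edge n}) (a c : 'I_n) :
  2 * b + 3 <= n -> a != c -> [set c; a] \in M ->
  (forall y, y != a -> y != c -> [set c; y] \in U) ->
  #|[set e in Kn n | (c \notin e) && (e \notin U)]| <= b + b ->
  win b M U.
Proof.
move=> nb ac Mca Uc few.
have cV : #|[set~ c]| = n.-1 by rewrite cardsC1 card_ord.
apply: (@win_star n b b c [set~ c] set0 _ _ _ M U [set a]).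
- by rewrite !inE eqxx.
- exact: sub0set.
- rewrite cV cards0 => k k_gt0; rewrite addn0; apply: star_count => //.
  by move: nb; clear; lia.
- by rewrite sub1set !inE.
- by rewrite disjoint_sym disjoints_subset sub0set.
- by rewrite cards1.
- by move=> x /set1P->.
- by move=> y; rewrite !inE => /andP[ya yc]; apply: Uc.
- by move=> p; rewrite inE.
rewrite cards1 muln1; apply: leq_trans few; apply/subset_leq_card/subsetP=> e.
rewrite !inE => /and4P[-> seV _ ->]; rewrite andbT /=.
by apply/negP => ce; move: (subsetP seV _ ce); rewrite !inE eqxx.
Qed.

(** Dropping [c], [u], [w] leaves at least [2 * b] vertices, but the stars at [u] and [w] then block
    nothing: only [A] counts, so [beta] is 0. *)
Lemma win_two_edges n b (M U A : {set edge n}) (a c p q u w : 'I_n) :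
  2 * b + 3 <= n -> uniq [:: c; a; p; q] ->
  (forall x, x \in [:: c; a; p; q] -> x \notin [:: u; w]) ->
  [set c; a] \in M -> [set p; q] \in M ->
  #|A| <= b -> (forall e, e \in A -> a \in e) ->
  (forall e, e \in Kn n -> u \notin e -> w \notin e -> e != [set c; a] ->
     e != [set p; q] -> e \notin A -> e \in U) ->
  win b M U.
Proof.
move=> nb uniq4 avoid Mca Mpq cA stA openU.
have [cuw auw puw quw] : [/\ c \notin [:: u; w], a \notin [:: u; w],
    p \notin [:: u; w] & q \notin [:: u; w]].
  by split; apply: avoid; rewrite !inE eqxx ?orbT.
move: uniq4 cuw auw puw quw; rewrite /= !inE !negb_or.
move=> /and4P[/and3P[ca cp cq] /andP[ap aq] pq _].
move=> /andP[cu cw] /andP[au aw] /andP[pu pw] /andP[qu qw].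
pose V : {set 'I_n} := ~: [set c; u; w].
have cardV : n <= #|V| + 3.
  by apply: cardsC_geq; rewrite -setUA cardsU1 cards2; do 2!case: (~~ _).
have inV y : (y \in V) = [&& y != c, y != u & y != w].
  by rewrite !inE !negb_or andbA.
have pqV : [set p; q] \subset V.
  by apply/subsetP=> y /set2P[->|->];
    rewrite inV eq_sym ?cp ?cq ?pu ?pw ?qu ?qw.
apply: (@win_star n b 0 c V [set p; q] _ _ _ M U [set a]) => //.
- by rewrite inV eqxx.
- rewrite cards2 pq => k; rewrite add0n; apply: star_count_pair.
  by move: nb cardV; clear; lia.
- by rewrite sub1set inV eq_sym ca au aw.
- by rewrite disjoints1 !inE negb_or ap aq.
- by rewrite cards1.
- by move=> x /set1P->.
- move=> y; rewrite in_setD in_set1 inV => /and4P[ya yc yu yw].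
  apply: openU; rewrite ?in_Kn ?inE ?negb_or 1?[c == y]eq_sym //.
  + by rewrite ![_ == c]eq_sym ![_ == y]eq_sym cu yu.
  + by rewrite ![_ == c]eq_sym ![_ == y]eq_sym cw yw.
  + by rewrite setUC set2_neq.
  + by rewrite set2_neq.
  by apply/negP => /stA; rewrite !inE ![a == _]eq_sym (negPf ca) (negPf ya).
- move=> y /set2P[->|->].
    by exists q; rewrite // !inE eqxx orbT andbT eq_sym.
  by exists p; rewrite ?[[set q; p]]setUC // !inE eqxx andbT.
rewrite cards1 muln1 add0n; apply: leq_trans cA.
apply/subset_leq_card/subsetP=> e; rewrite inE => /and4P[eK seV spq nUe].
have nV y : y \notin V -> y \notin e by apply/contraNN/subsetP.
apply: contraNT nUe => nAe; apply: openU => //.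
- by apply: nV; rewrite inV eqxx andbF.
- by apply: nV; rewrite inV eqxx !andbF.
- apply: contraTneq seV => ->; apply/subsetPn; exists c; rewrite ?inV ?eqxx //.
  by rewrite !inE eqxx.
by apply: contraNneq spq => ->.
Qed.

Lemma star_untouched n (A : {set edge n}) (u : 'I_n) :
  A \subset Kn n -> (forall e, e \in A -> u \in e) -> #|A| + 3 <= n ->
  exists x y, [/\ x != y, u \notin [:: x; y]
    & forall e, e \in A -> (x \notin e) && (y \notin e)].
Proof.
(* [Y] is the set of leaves; it injects into [A], so two vertices lie outside [u |: Y]. *)
move=> sAK stA cA; pose Y := [set y | (y != u) && ([set u; y] \in A)].
have cY : #|Y| <= #|A|.
  have injY : {in Y &, injective (fun y => [set u; y])}.
    move=> y z; rewrite !inE => /andP[yu _] _ /setP/(_ y).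
    by rewrite !inE eqxx (negPf yu) /= => /esym/eqP.
  rewrite -(card_in_imset injY); apply/subset_leq_card/subsetP=> e.
  by case/imsetP=> y; rewrite inE => /andP[_ Auy] ->.
have : 1 < #|~: (u |: Y)|.
  have cuY : #|u |: Y| <= #|A| + 1.
    by rewrite cardsU1 addnC leq_add // leq_b1.
  rewrite -(leq_add2r (#|A| + 1)); apply: leq_trans (cardsC_geq cuY).
  by rewrite addnCA.
have untouched x e : x != u -> x \notin Y -> e \in A -> x \notin e.
  rewrite inE => xu; rewrite xu => nAx Ae.
  have [y uy def_e] := KnP (subsetP sAK _ Ae) (stA _ Ae).
  rewrite def_e !inE (negPf xu) /=; apply: contraNneq nAx => ->.
  by rewrite -def_e.
case/card_gt1P=> x [y []]; rewrite !in_setC !in_setU1 !negb_or.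
move=> /andP[xu xY] /andP[yu yY] xy; exists x, y; split=> // [|e Ae].
  by rewrite !inE negb_or ![u == _]eq_sym xu yu.
by apply/andP; split; apply: untouched.
Qed.

Lemma win_start n b (A1 : {set edge n}) : 2 * b + 3 <= n ->
  A1 \subset Kn n -> #|A1| <= b -> star A1 -> win b set0 (Kn n :\: A1).
Proof.
move=> nb sA1 cA1 [u stA1].
have [|a [c [ac]]] := star_untouched sA1 stA1;
  first by apply: leq_trans nb; rewrite leq_add2r (leq_trans cA1) ?leq_pmull.
rewrite !inE negb_or => /andP[ua uc] nA1.
pose e0 : edge n := [set c; a].
have ca : c != a by rewrite eq_sym.
have Ue0 : e0 \in Kn n :\: A1.
  rewrite in_setD in_Kn ca andbT; apply/negP => /nA1.
  by rewrite !inE eqxx orbT.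
apply: (win_move Ue0) => A2 sA2 cA2 [w stA2].
have U2P e : e \in Kn n :\: A1 :\ e0 :\: A2 =
    [&& e \notin A2, e != e0, e \notin A1 & e \in Kn n].
  by rewrite !in_setD in_set1.
(* Either end of [e0] can be the untouched centre. *)
have end_free x y : e0 = [set x; y] -> y != x ->
    (forall e, e \in A1 -> x \notin e) -> (forall e, e \in A2 -> x \notin e) ->
    win b (e0 |: set0) (Kn n :\: A1 :\ e0 :\: A2).
  move=> def_e0 yx nA1x nA2x.
  apply: (@win_untouched_end n b _ _ y x) => // [|z zy zx|].
  - by rewrite -def_e0 !inE eqxx.
  - rewrite U2P in_Kn [x == z]eq_sym zx andbT def_e0.
    rewrite [[set x; z]]setUC set2_neq //=; apply/andP; split.
      by apply/negP => /nA2x; rewrite !inE eqxx orbT.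
    by apply/negP => /nA1x; rewrite !inE eqxx orbT.
  apply: leq_trans (leq_add cA1 cA2); apply: leq_trans (leq_card_setU A1 A2).
  apply/subset_leq_card/subsetP=> e; rewrite inE U2P => /and3P[-> xe].
  rewrite andbT; have -> : e != e0.
    by apply: contraNneq xe => ->; rewrite def_e0 !inE eqxx.
  by rewrite in_setU negb_and !negbK orbC.
have [/existsP[e1 /andP[A2e1 ce1]]|] := boolP [exists e in A2, c \in e];
  last first.
  move/exists_inPn=> nA2; apply: (@end_free c a) => // e.
  by case/nA1/andP.
have [/existsP[e2 /andP[A2e2 ae2]]|] := boolP [exists e in A2, a \in e];
  last first.
  move/exists_inPn=> nA2; apply: (@end_free a c) => // [|e].
    by rewrite /e0 setUC.
  by case/nA1/andP.
have inA2 e : e \in A2 -> e != e0 /\ e \in Kn n.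
  by move=> /(subsetP sA2); rewrite !in_setD in_set1 => /and3P[].
have not_both e : e \in A2 -> a \in e -> c \notin e.
  move=> /inA2[ne0 eK] ae; apply: contra ne0 => ce.
  have [y ay def_e] := KnP eK ae.
  move: ce; rewrite def_e !inE (negPf ca) /= => /eqP<-.
  by rewrite setUC.
(* Were [w] an end of [e0], the edge of [A2] at the other end would be [e0], already claimed. *)
have wc : w != c by apply: contraNneq (not_both _ A2e2 ae2) => <-; apply: stA2.
have wa : w != a.
  by apply: contraTneq ce1 => wa; apply: not_both; rewrite // -wa stA2.
(* This yields [7 <= n], leaving room for [p] and [q] outside four vertices. *)
have b_gt1 : 1 < b.
  apply: leq_trans cA2; apply/card_gt1P; exists e1, e2; split=> //.
  by apply: contraTneq ce1 => ->; apply: not_both.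
have : 1 < #|~: [set c; a; u; w]|.
  have c4 : #|[set c; a; u; w]| <= 4.
    by rewrite -!setUA !cardsU1 cards1; do 3!case: (_ \notin _).
  rewrite -(leq_add2r 4); apply: leq_trans (cardsC_geq c4).
  apply: leq_trans nb; apply: (@leq_trans (2 * 2 + 3)) => //.
  by rewrite leq_add2r leq_mul2l b_gt1.
case/card_gt1P=> p [q []]; rewrite !inE !negb_or -!andbA.
move=> /and4P[pc pa pu pw] /and4P[qc qa qu qw] pq.
pose e3 : edge n := [set p; q].
have avoid e : e \in Kn n -> u \notin e -> w \notin e -> e != e0 ->
    e \in Kn n :\: A1 :\ e0 :\: A2.
  move=> eK ue we ne0; rewrite U2P eK ne0 andbT /=.
  by rewrite (contra (stA2 e)) ?(contra (stA1 e)).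
have Ue3 : e3 \in Kn n :\: A1 :\ e0 :\: A2.
  apply: avoid; rewrite ?in_Kn // ?set2_neq // !inE negb_or;
    rewrite ![_ == p]eq_sym ![_ == q]eq_sym.
    by rewrite pu qu.
  by rewrite pw qw.
apply: (win_move Ue3) => A3 _ cA3 [t stA3].
set M := e3 |: _; set U := _ :\: A3.
have Me0 : e0 \in M by rewrite !inE eqxx orbT.
have Me3 : e3 \in M by rewrite !inE eqxx.
have openU e : e \in Kn n -> u \notin e -> w \notin e -> e != e0 -> e != e3 ->
    e \notin A3 -> e \in U.
  by move=> *; rewrite in_setD in_setD1; apply/and3P; split=> //; apply: avoid.
have uniq4 : uniq [:: c; a; p; q].
  by rewrite /= !inE !negb_or ![c == _]eq_sym ![a == _]eq_sym ca pc qc pa qa pq.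
have far x : x \in [:: c; a; p; q] -> x \notin [:: u; w].
  rewrite !inE => /or4P[] /eqP->; rewrite negb_or ?pu ?qu //.
    by rewrite ![c == _]eq_sym uc.
  by rewrite ![a == _]eq_sym ua.
(* When [t] is an end of one of Maker's edges, the new star grows at the other end [x] of that
   edge. *)
have two_edges x y z s : perm_eq [:: x; y; z; s] [:: c; a; p; q] -> t = y ->
    [set x; y] = e0 /\ [set z; s] = e3 \/ [set x; y] = e3 /\ [set z; s] = e0 ->
    win b M U.
  move=> perm4 ty edges; rewrite ty in stA3.
  apply: (@win_two_edges n b M U A3 y x z s u w) => //.
  - by rewrite (perm_uniq perm4).
  - by move=> v; rewrite (perm_mem perm4); apply: far.
  - by case: edges => -[-> _].
  - by case: edges => -[_ ->].
  by move=> e eK ue we; case: edges => -[-> ->] *; apply: openU.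
have [|nt4] := boolP (t \in [:: c; a; p; q]).
  have e0C : [set a; c] = e0 by apply: setUC.
  have e3C : [set q; p] = e3 by apply: setUC.
  rewrite !inE => /or4P[] /eqP def_t.
  - apply: (@two_edges a c p q) => //; last by left.
    by rewrite (perm_catCA [:: a] [:: c] [:: p; q]).
  - by apply: (@two_edges c a p q) => //; left.
  - apply: (@two_edges q p c a) => //; last by right.
    by rewrite (perm_catC [:: q; p] [:: c; a]) /= !perm_cons
      (perm_catC [:: q] [:: p]).
  - apply: (@two_edges p q c a) => //; last by right.
    by rewrite (perm_catC [:: p; q] [:: c; a]).
(* No edge between [e0] and [e3] contains any of the centres [u], [w], [t]. *)
have cross x y : x \in [:: c; a] -> y \in [:: p; q] -> [set x; y] \in U.
  move=> xca ypq; have x4 : x \in [:: c; a; p; q].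
    by rewrite (mem_cat x [:: c; a] [:: p; q]) xca.
  have y4 : y \in [:: c; a; p; q].
    by rewrite (mem_cat y [:: c; a] [:: p; q]) ypq orbT.
  have /andP[yc ya] : (y != c) && (y != a).
    by move: ypq; rewrite !inE => /orP[] /eqP->; rewrite ?pc ?qc.
  have /andP[xp xq] : (x != p) && (x != q).
    by move: xca; rewrite !inE => /orP[] /eqP->;
       rewrite ![_ == p]eq_sym ![_ == q]eq_sym ?pc ?pa.
  have xy : x != y by move: ypq; rewrite !inE => /orP[] /eqP->.
  have /andP[xu xw] : (x != u) && (x != w).
    by have := far _ x4; rewrite !inE negb_or.
  have /andP[yu yw] : (y != u) && (y != w).
    by have := far _ y4; rewrite !inE negb_or.
  apply: openU; rewrite ?in_Kn //.
  - by rewrite !inE negb_or ![u == _]eq_sym xu.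
  - by rewrite !inE negb_or ![w == _]eq_sym xw.
  - by rewrite [[set x; y]]setUC set2_neq.
  - by rewrite set2_neq.
  by apply: contra nt4 => /stA3/set2P[]->.
by apply: (@win_double_threat n b M U c a p q) => //; apply: cross;
  rewrite !inE eqxx ?orbT.
Qed.

Theorem theorem5p1 (n b : nat)
    (hb : (b%:R < 'C(n.-1, 2)%:R / n%:R :> rat)%R) :
  maker_wins_triangle_game n b.
Proof.
have n_gt0 : 0 < n.
  (* Division by zero yields 0, so [n = 0] would make [b] negative. *)
  by case: n hb => //; rewrite GRing.invr0 GRing.mulr0 Num.Theory.ltrn0.
move: hb; rewrite Num.Theory.ltr_pdivlMr ?Num.Theory.ltr0n //.
rewrite -GRing.natrM Num.Theory.ltr_nat => hb.
apply: maker_wins_of_win => // A; apply: win_start; move: hb; clear.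
(* Doubling gives [2bn < (n-1)(n-2)], that is [n(2b+3) < n^2 + 2], whence [2b+3 <= n] once [n] is at
   least 2. *)
by have := double_bin2 n.-1; case: n => [|[|m]] //=; nia.
Qed.
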